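(* Let $(\mathfrak g,\nu)$ be a Lie algebra over a field of characteristic zero, and regard it as the Hom-Lie algebra $(\mathfrak g,\nu,\mathrm{id})$. Then for every $n\ge1$ $$\widetilde H^n(\mathfrak g,\mathfrak g)\cong H^n(\mathfrak g,\mathfrak g)\oplus H^{n-1}(\mathfrak g,\mathfrak g),$$ where $\widetilde H^\bullet(\mathfrak g,\mathfrak g)$ is the $\alpha$-type cohomology of $(\mathfrak g,\nu,\mathrm{id})$ with values in itself, and $H^\bullet(\mathfrak g,\mathfrak g)$ denotes the ordinary Chevalley–Eilenberg cohomology of $\mathfrak g$ with values in the adjoint module, but with $H^1(\mathfrak g,\mathfrak g)$ replaced by the space $\mathrm{Der}(\mathfrak g)$ of derivations of $\mathfrak g$ and $H^0(\mathfrak g,\mathfrak g)$ replaced by $\{0\}$.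
   Context: A Hom-Lie algebra $(\mathfrak g,\nu,\alpha)$ is a vector space with a linear map $\alpha$ and a skew-symmetric bilinear bracket $\nu(x\otimes y)=[x,y]$ with $[[x,y],\alpha(z)]+[[y,z],\alpha(x)]+[[z,x],\alpha(y)]=0$ and $\alpha([x,y])=[\alpha(x),\alpha(y)]$. Its $\alpha$-type cohomology $\widetilde H^\bullet(\mathfrak g,\mathfrak g)$ is the cohomology of the complex $\widetilde C^n(\mathfrak g)=\mathrm{Hom}(\Lambda^n\mathfrak g,\mathfrak g)\oplus\mathrm{Hom}(\Lambda^{n-1}\mathfrak g,\mathfrak g)\ni(\varphi,\psi)$, where $\mathrm{Hom}(\Lambda^k\mathfrak g,\mathfrak g)$ is set to $0$ for $k\le0$ (including $k=0$), with differential $\partial(\varphi,\psi)=(\partial_{\nu\nu}\varphi-\partial_{\alpha\nu}\psi,\ \partial_{\nu\alpha}\varphi-\partial_{\alpha\alpha}\psi)$, where (hats denote omission) $$(\partial_{\nu\nu}\varphi)(x_1,\dots,x_{n+1})=\sum_{i}(-1)^{i+1}[\alpha^{n-1}(x_i),\varphi(\dots,\widehat{x_i},\dots)]-\sum_{i<j}(-1)^{i+j-1}\varphi([x_i,x_j],\alpha(x_1),\dots,\widehat{x_i},\dots,\widehat{x_j},\dots,\alpha(x_{n+1})),$$ $$(\partial_{\alpha\alpha}\psi)(x_1,\dots,x_n)=\sum_{i}(-1)^{i+1}[\alpha^{n-1}(x_i),\psi(\dots,\widehat{x_i},\dots)]-\sum_{i<j}(-1)^{i+j-1}\psi([x_i,x_j],\alpha(x_1),\dots,\widehat{x_i},\dots,\widehat{x_j},\dots,\alpha(x_n)),$$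 $$(\partial_{\nu\alpha}\varphi)(x_1,\dots,x_n)=\alpha(\varphi(x_1,\dots,x_n))-\varphi(\alpha(x_1),\dots,\alpha(x_n)),$$ $$(\partial_{\alpha\nu}\psi)(x_1,\dots,x_{n+1})=\sum_{i<j}(-1)^{i+j-1}[[\alpha^{n-2}(x_i),\alpha^{n-2}(x_j)],\psi(\dots,\widehat{x_i},\dots,\widehat{x_j},\dots)].$$ *)

(* Defs.v *)
From HB Require Import structures.
From mathcomp Require Import all_boot all_order all_algebra.
From mathcomp Require Import boolp classical_sets functions.

Set Implicit Arguments.
Unset Strict Implicit.
Unset Printing Implicit Defensive.

Import GRing.Theory.
Local Open Scope ring_scope.
Local Open Scope quotient_scope.

Section Submodules.
Variables (K : fieldType) (V : lmodType K).

Record submodule (S : submodClosed V) :=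
  Submodule { submodule_val :> V; _ : submodule_val \in S }.

HB.instance Definition _ (S : submodClosed V) :=
  [isSub for @submodule_val S].
HB.instance Definition _ (S : submodClosed V) := [Choice of submodule S by <:].
HB.instance Definition _ (S : submodClosed V) :=
  [SubChoice_isSubLmodule of submodule S by <:].

(* The quotient of the library is by a zmodClosed predicate, and submodClosed
   does not inherit from zmodClosed. *)
Definition submod_pred (S : submodClosed V) : {pred V} := S.

HB.instance Definition _ (S : submodClosed V) := GRing.isZmodClosed.Build V
  (submod_pred S) (GRing.submod_closedB (submodClosedP S)).

Definition quotient_module (S : submodClosed V) := Quotient.quot (submod_pred S).

Section QuotientModule.
Variable S : submodClosed V.
Local Notation Q := (quotient_module S).

HB.instance Definition _ := GRing.Zmodule.on Q.

Definition quotient_scale (a : K) (u : Q) : Q := \pi_Q (a *: repr u).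

Lemma pi_eq (x y : V) : (\pi_Q x == \pi_Q y) = (x - y \in S).
Proof. exact: esym (Quotient.idealrBE _ _ _). Qed.

Lemma quotient_scale_pi (a : K) (x : V) :
  quotient_scale a (\pi_Q x) = \pi_Q (a *: x).
Proof.
apply/eqP; rewrite pi_eq -scalerBr; apply: rpredZ.
by rewrite -pi_eq reprK.
Qed.

Lemma pi_surj (u : Q) : exists x : V, u = \pi_Q x.
Proof. by exists (repr u); rewrite reprK. Qed.

Lemma quotient_scaleA a b (u : Q) :
  quotient_scale a (quotient_scale b u) = quotient_scale (a * b) u.
Proof. by have [x ->] := pi_surj u; rewrite !quotient_scale_pi scalerA. Qed.

Lemma quotient_scale1 : left_id 1 quotient_scale.
Proof.
by move=> u; have [x ->] := pi_surj u; rewrite quotient_scale_pi scale1r.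
Qed.

Lemma quotient_scaleDr : right_distributive quotient_scale +%R.
Proof.
move=> a u v; have [x ->] := pi_surj u; have [y ->] := pi_surj v.
by rewrite -[_ + _]raddfD !quotient_scale_pi scalerDr raddfD.
Qed.

Lemma quotient_scaleDl u :
  {morph (fun a => quotient_scale a u) : a b / a + b >-> a + b}.
Proof.
move=> a b; have [x ->] := pi_surj u.
by rewrite /= !quotient_scale_pi scalerDl raddfD.
Qed.

HB.instance Definition _ := GRing.Zmodule_isLmodule.Build K Q
  quotient_scaleA quotient_scale1 quotient_scaleDr quotient_scaleDl.

End QuotientModule.

Definition sub_preim (Z B : submodClosed V) : {pred submodule Z} :=
  [pred z | \val z \in B].
Arguments sub_preim : clear implicits.

Lemma sub_preim_closed (Z B : submodClosed V) : submod_closed (sub_preim Z B).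
Proof.
split=> [|a x y]; first by rewrite inE raddf0 rpred0.
by rewrite !inE => xB yB; rewrite linearP rpredD ?rpredZ.
Qed.

HB.instance Definition _ (Z B : submodClosed V) :=
  GRing.isSubmodClosed.Build K (submodule Z) (sub_preim Z B)
    (@sub_preim_closed Z B).

End Submodules.
Arguments sub_preim {K V} Z B _.

(* Z / (Z :&: B), that is, Z / B as soon as B is contained in Z. *)
Definition subquotient (K : fieldType) (V : lmodType K)
    (Z B : submodClosed V) : lmodType K :=
  quotient_module (sub_preim Z B).

Definition lmod_isomorphic (K : fieldType) (U V : lmodType K) : Prop :=
  exists f : {linear U -> V}, bijective f.

Section Cochains.
Variables (K : fieldType) (g : lmodType K).

Definition multimap n : lmodType K := {ffun 'I_n -> g} -> g.

Definition upd n (x : {ffun 'I_n -> g}) (i : 'I_n) (u : g) : {ffun 'I_n -> g} :=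
  [ffun k => if k == i then u else x k].

Definition is_alternating n (f : multimap n) : Prop :=
  (forall x i, linear (fun u => f (upd x i u)))
  /\ (forall (x : {ffun 'I_n -> g}) i j, i != j -> x i = x j -> f x = 0).

(* Hom (Lambda^n g, g), as the space of alternating n-linear maps; for n = 0
   it is a copy of g. *)
Definition altmap n : {pred multimap n} := [pred f | `[< is_alternating f >]].
Arguments altmap : clear implicits.

Lemma altmap_closed n : submod_closed (altmap n).
Proof.
split=> [|a f h].
  by apply/asboolP; split=> // x i b u v; rewrite scaler0 addr0.
move=> /asboolP[fl fa] /asboolP[hl ha]; apply/asboolP; split=> [x i b u v|x i j ij xij].
  rewrite !fctE fl hl !scalerDr !scalerA mulrC.
  by rewrite addrACA.
by rewrite !fctE (fa _ _ _ ij) // (ha _ _ _ ij) // scaler0 addr0.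
Qed.

HB.instance Definition _ n :=
  GRing.isSubmodClosed.Build K (multimap n) (altmap n) (@altmap_closed n).

(* The same, except that it is 0 for n = 0. *)
Definition altmap_pos n : {pred multimap n} :=
  [pred f | (f \in altmap n) && ((n == 0%N) ==> (f == 0))].
Arguments altmap_pos : clear implicits.

Lemma altmap_pos_closed n : submod_closed (altmap_pos n).
Proof.
split=> [|a f h]; first by apply/andP; rewrite rpred0 eqxx implybT.
move=> /andP[fA /implyP f0] /andP[hA /implyP h0]; apply/andP; split.
  by rewrite rpredD ?rpredZ.
by apply/implyP => n0; rewrite (eqP (f0 n0)) (eqP (h0 n0)) scaler0 addr0.
Qed.

HB.instance Definition _ n :=
  GRing.isSubmodClosed.Build K (multimap n) (altmap_pos n)
    (@altmap_pos_closed n).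

(* The argument list s, which has m elements wherever args m s is used with
   m > 0, as an m-tuple of vectors. *)
Definition args m (s : seq g) : {ffun 'I_m -> g} := [ffun k : 'I_m => s`_k].

End Cochains.
Arguments altmap {K} g n _.
Arguments altmap_pos {K} g n _.
Arguments args {K g} m s.

Record homLie (K : fieldType) := HomLie {
  hl_car :> lmodType K;
  hl_br : {bilinear hl_car -> hl_car -> hl_car};
  hl_alpha : {linear hl_car -> hl_car};
  hl_skew : forall x y, hl_br x y = - hl_br y x;
  hl_jacobi : forall x y z,
    hl_br (hl_br x y) (hl_alpha z) + hl_br (hl_br y z) (hl_alpha x)
      + hl_br (hl_br z x) (hl_alpha y) = 0;
  hl_mult : forall x y, hl_alpha (hl_br x y) = hl_br (hl_alpha x) (hl_alpha y)
}.

(* Positions are numbered from 0 in all the differentials below, so that the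
   signs (-1)^(i+1), (-1)^(i+j-1) and (-1)^(i+j) of the usual formulas, with
   positions numbered from 1, become (-1)^i, (-1)^(i+j+1) and (-1)^(i+j). The
   truncated powers n.-1 and n.-2 of alpha differ from n - 1 and n - 2 only on
   cochains which are 0. *)

Section AlphaType.
Variables (K : fieldType) (g : homLie K).
Local Notation "[[ x , y ]]" := (@hl_br K g x y) (at level 0).
Local Notation alpha := (@hl_alpha K g).
Local Notation M n := (multimap g n).

(* Common shape of the two diagonal components: m is the number of arguments
   of the result, and e the power of alpha in the first sum. *)
Definition alpha_delta e m (f : M m.-1) : M m := fun x =>
  \sum_(i < m) (-1 : K) ^+ i *:
     [[ iter e alpha (x i),
        f (args m.-1 [seq x k | k <- enum 'I_m & k != i]) ]]
  - \sum_(i < m) \sum_(j < m | (i < j)%N) (-1 : K) ^+ (i + j).+1 *: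
     f (args m.-1 ([[ x i, x j ]] ::
          [seq alpha (x k) | k <- enum 'I_m & (k != i) && (k != j)])).

Definition d_nunu n (phi : M n) : M n.+1 := @alpha_delta n.-1 n.+1 phi.

Definition d_aa n (psi : M n.-1) : M n := @alpha_delta n.-1 n psi.

Definition d_nua n (phi : M n) : M n := fun x =>
  alpha (phi x) - phi [ffun k : 'I_n => alpha (x k)].

Definition d_anu n (psi : M n.-1) : M n.+1 := fun x =>
  \sum_(i < n.+1) \sum_(j < n.+1 | (i < j)%N) (-1 : K) ^+ (i + j).+1 *:
     [[ [[ iter n.-2 alpha (x i), iter n.-2 alpha (x j) ]],
        psi (args n.-1 [seq x k | k <- enum 'I_n.+1 & (k != i) && (k != j)]) ]].

Definition alpha_ambient n : lmodType K := (M n * M n.-1)%type.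

Definition alpha_diff n (c : alpha_ambient n) : alpha_ambient n.+1 :=
  (d_nunu c.1 - d_anu c.2, d_nua c.1 - d_aa c.2).

Lemma alpha_delta_linear e m : linear (@alpha_delta e m).
Proof.
move=> a f h; apply/funext => x; rewrite !fctE /alpha_delta.
rewrite scalerBr !scaler_sumr addrACA -opprD -!big_split /=.
congr (_ - _); apply: eq_bigr => i _.
  by rewrite linearPr scalerDr !scalerA mulrC.
rewrite scaler_sumr -big_split; apply: eq_bigr => j _ /=.
by rewrite scalerDr !scalerA mulrC.
Qed.

Lemma d_anu_linear n : linear (@d_anu n).
Proof.
move=> a f h; apply/funext => x; rewrite !fctE /d_anu.
rewrite scaler_sumr -big_split; apply: eq_bigr => i _ /=.
rewrite scaler_sumr -big_split; apply: eq_bigr => j _ /=.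
by rewrite linearPr scalerDr !scalerA mulrC.
Qed.

Lemma d_nua_linear n : linear (@d_nua n).
Proof.
move=> a f h; apply/funext => x; rewrite /d_nua !fctE.
by rewrite linearP scalerBr opprD addrACA.
Qed.

Lemma alpha_diff_linear n : linear (@alpha_diff n).
Proof.
have lin_sub (U : lmodType K) (a : K) (u u' v v' : U) :
    a *: u + u' - (a *: v + v') = a *: (u - v) + (u' - v').
  by rewrite opprD addrACA scalerBr.
move=> a c c'; rewrite /alpha_diff /d_nunu /d_aa /=.
rewrite !alpha_delta_linear d_anu_linear d_nua_linear.
by congr (_, _); exact: lin_sub.
Qed.

HB.instance Definition _ n := GRing.isLinear.Build K
  (alpha_ambient n) (alpha_ambient n.+1) _ (@alpha_diff n) (@alpha_diff_linear n).

Definition alpha_cochain n : {pred alpha_ambient n} :=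
  [pred c | (c.1 \in altmap_pos g n) && (c.2 \in altmap_pos g n.-1)].

Lemma alpha_cochain_closed n : submod_closed (@alpha_cochain n).
Proof.
split=> [|a c c']; first by apply/andP; rewrite !rpred0.
by move=> /andP[c1 c2] /andP[c1' c2']; apply/andP; rewrite !rpredD ?rpredZ.
Qed.

HB.instance Definition _ n := GRing.isSubmodClosed.Build K
  (alpha_ambient n) (@alpha_cochain n) (@alpha_cochain_closed n).

Definition alpha_cocycle n : {pred alpha_ambient n} :=
  [pred c | (c \in @alpha_cochain n) && (alpha_diff c == 0)].

Lemma alpha_cocycle_closed n : submod_closed (@alpha_cocycle n).
Proof.
split=> [|a c c']; first by apply/andP; rewrite rpred0 linear0 eqxx.
move=> /andP[c1 /eqP c2] /andP[c1' /eqP c2']; apply/andP.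
by rewrite rpredD ?rpredZ // alpha_diff_linear c2 c2' scaler0 addr0 eqxx.
Qed.

HB.instance Definition _ n := GRing.isSubmodClosed.Build K
  (alpha_ambient n) (@alpha_cocycle n) (@alpha_cocycle_closed n).

Definition alpha_coboundary n : {pred alpha_ambient n} :=
  match n with
  | 0 => [pred c | c == 0]
  | m.+1 => [pred c | `[< exists2 b, b \in @alpha_cochain m & alpha_diff b = c >]]
  end.

Lemma alpha_coboundary_closed n : submod_closed (@alpha_coboundary n).
Proof.
case: n => [|n]; split=> [|a c c'].
- by rewrite inE.
- by move=> /eqP c0 /eqP c0'; apply/eqP; rewrite c0 c0' scaler0 addr0.
- by apply/asboolP; exists 0; rewrite ?rpred0 ?linear0.
move=> /asboolP[b bC <-] /asboolP[b' b'C <-]; apply/asboolP.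
by exists (a *: b + b'); rewrite ?alpha_diff_linear // rpredD ?rpredZ.
Qed.

HB.instance Definition _ n := GRing.isSubmodClosed.Build K
  (alpha_ambient n) (@alpha_coboundary n) (@alpha_coboundary_closed n).

Definition alpha_cohomology n : lmodType K :=
  subquotient (@alpha_cocycle n) (@alpha_coboundary n).

End AlphaType.

Record lieAlgebra (K : fieldType) := LieAlgebra {
  lie_car :> lmodType K;
  lie_br : {bilinear lie_car -> lie_car -> lie_car};
  lie_alt : forall x, lie_br x x = 0;
  lie_jacobi : forall x y z,
    lie_br (lie_br x y) z + lie_br (lie_br y z) x + lie_br (lie_br z x) y = 0
}.

Section LieAlgebra.
Variables (K : fieldType) (g : lieAlgebra K).
Local Notation "[[ x , y ]]" := (@lie_br K g x y) (at level 0).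
Local Notation M n := (multimap g n).

Lemma lie_skew (x y : g) : [[ x, y ]] = - [[ y, x ]].
Proof.
apply/eqP; rewrite -addr_eq0; apply/eqP.
have := lie_alt (x + y).
by rewrite linearDl !linearDr !lie_alt add0r addr0.
Qed.

Definition homLie_of_lie : homLie K :=
  @HomLie K g (@lie_br K g) idfun lie_skew (@lie_jacobi K g)
    (fun x y => erefl).

Definition ce_diff n (phi : M n) : M n.+1 := fun x =>
  \sum_(i < n.+1) (-1 : K) ^+ i *:
     [[ x i, phi (args n [seq x k | k <- enum 'I_n.+1 & k != i]) ]]
  + \sum_(i < n.+1) \sum_(j < n.+1 | (i < j)%N) (-1 : K) ^+ (i + j) *:
     phi (args n ([[ x i, x j ]] ::
            [seq x k | k <- enum 'I_n.+1 & (k != i) && (k != j)])).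

Lemma ce_diff_linear n : linear (@ce_diff n).
Proof.
move=> a f h; apply/funext => x; rewrite !fctE /ce_diff.
rewrite scalerDr !scaler_sumr addrACA -!big_split /=.
apply: eq_bigr => i _; congr (_ + _).
  by rewrite linearPr scalerDr !scalerA mulrC.
rewrite scaler_sumr -big_split; apply: eq_bigr => j _ /=.
by rewrite scalerDr !scalerA mulrC.
Qed.

HB.instance Definition _ n := GRing.isLinear.Build K
  (M n) (M n.+1) _ (@ce_diff n) (@ce_diff_linear n).

Definition ce_cocycle n : {pred M n} :=
  [pred c | (c \in altmap g n) && (ce_diff c == 0)].

Lemma ce_cocycle_closed n : submod_closed (@ce_cocycle n).
Proof.
split=> [|a c c']; first by apply/andP; rewrite rpred0 linear0 eqxx.
move=> /andP[c1 /eqP c2] /andP[c1' /eqP c2']; apply/andP.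
by rewrite rpredD ?rpredZ // ce_diff_linear c2 c2' scaler0 addr0 eqxx.
Qed.

HB.instance Definition _ n := GRing.isSubmodClosed.Build K
  (M n) (@ce_cocycle n) (@ce_cocycle_closed n).

Definition ce_coboundary n : {pred M n} :=
  match n with
  | 0 => [pred c | c == 0]
  | m.+1 => [pred c | `[< exists2 b, b \in altmap g m & ce_diff b = c >]]
  end.

Lemma ce_coboundary_closed n : submod_closed (@ce_coboundary n).
Proof.
case: n => [|n]; split=> [|a c c'].
- by rewrite inE.
- by move=> /eqP c0 /eqP c0'; apply/eqP; rewrite c0 c0' scaler0 addr0.
- by apply/asboolP; exists 0; rewrite ?rpred0 ?linear0.
move=> /asboolP[b bC <-] /asboolP[b' b'C <-]; apply/asboolP.
by exists (a *: b + b'); rewrite ?ce_diff_linear // rpredD ?rpredZ.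
Qed.

HB.instance Definition _ n := GRing.isSubmodClosed.Build K
  (M n) (@ce_coboundary n) (@ce_coboundary_closed n).

Definition ce_cohomology n : lmodType K :=
  subquotient (@ce_cocycle n) (@ce_coboundary n).

Definition is_derivation (D : g -> g) : Prop :=
  linear D /\ forall x y, D [[ x, y ]] = [[ D x, y ]] + [[ x, D y ]].

Definition derivation : {pred (g -> g)} := [pred D | `[< is_derivation D >]].

Lemma derivation_closed : submod_closed derivation.
Proof.
split=> [|a D E].
  apply/asboolP; split=> [b u v|x y]; first by rewrite scaler0 addr0.
  by rewrite linear0l linear0r addr0.
move=> /asboolP[Dl DP] /asboolP[El EP]; apply/asboolP; split=> [b u v|x y].
  by rewrite !fctE Dl El !scalerDr !scalerA mulrC addrACA.
rewrite !fctE DP EP linearPr scalerDr.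
by rewrite linearDl linearZl_LR addrACA.
Qed.

HB.instance Definition _ := GRing.isSubmodClosed.Build K
  (g -> g) derivation derivation_closed.

Definition Der : lmodType K := submodule derivation.

(* Chevalley-Eilenberg cohomology in the adjoint module, with H^0 replaced by 0
   and H^1 by the space of derivations. *)
Definition modified_cohomology n : lmodType K :=
  match n with
  | 0 => 'rV[K]_0
  | 1 => Der
  | _ => ce_cohomology n
  end.

End LieAlgebra.

(* Main.v *)
From HB Require Import structures.
Require Import Defs.
From mathcomp Require Import all_boot all_order all_algebra.
From mathcomp Require Import boolp classical_sets functions.
From mathcomp Require Import perm zify.

(* Write the Chevalley-Eilenberg differential as [d = A + B], where [A] brackets
   one argument with the value of the cochain and [B] brackets two arguments.
   Reindexing gives [A B + B A = - D] and the Jacobi identity gives [A A = D],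
   where [D] is the component d_anu for alpha = id, so that [D = d A + A d].
   For alpha = id the alpha-type complex is the mapping cone of [D], and
   [(phi, psi) |-> (phi - A psi, psi)] splits it into a direct sum. *)

Set Implicit Arguments.
Unset Strict Implicit.
Unset Printing Implicit Defensive.

Import GRing.Theory.
Local Open Scope ring_scope.

(** * Positions in lists of ordinals after deletion of one or two entries *)

Lemma index_filter (I : eqType) (p : pred I) (s : seq I) (k : I) :
  p k -> index k (filter p s) = count p (take (index k s) s).
Proof.
move=> pk; elim: s => //= a s IH; have [->|ak] := eqVneq a k.
  by rewrite pk /= eqxx.
by case: ifP => pa /=; rewrite ?(negbTE ak) pa IH.
Qed.

(** Membership is added as a number, which avoids truncated subtraction and treats [i] outside [s]
    in the same way. *)
Lemma count_predD1 (I : eqType) (p : pred I) (s : seq I) (i : I) :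
  uniq s -> p i ->
  (count (fun l => p l && (l != i)) s + (i \in s) = count p s)%N.
Proof.
move=> us pi; elim: s us => //= a s IH /andP[aNs us].
rewrite inE -(IH us) [i == a]eq_sym; have [ai|ai] /= := eqVneq a i; last first.
  by rewrite andbT addnA.
by rewrite ai pi -ai (negbTE aNs) andbF; lia.
Qed.

Lemma mem_take_enum_ord n (i : 'I_n) k :
  (i \in take k (enum 'I_n)) = (i < k)%N.
Proof. by rewrite in_take ?mem_enum // index_enum_ord. Qed.

(** Deleting [i] moves each later entry down by one place. All sign corrections below come from this
    shift and its analogue for two deletions. *)
Lemma index_enum_D1 n (i k : 'I_n) : k != i ->
  (index k [seq l <- enum 'I_n | l != i] + (i < k)%N)%N = k.
Proof.
move=> ki; rewrite index_filter // index_enum_ord -(mem_take_enum_ord i).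
rewrite (count_predD1 (p := predT)) ?take_uniq ?enum_uniq //.
by rewrite count_predT size_takel // size_enum_ord ltnW.
Qed.

Lemma ltn_index_enum_D1 n (i j k : 'I_n) : i != k -> j != k ->
  (index i [seq l <- enum 'I_n | l != k] <
   index j [seq l <- enum 'I_n | l != k])%N = (i < j)%N.
Proof.
move=> ik jk; have := index_enum_D1 ik; have := index_enum_D1 jk.
move: ik jk; rewrite -!val_eqE /=.
by case: (ltnP k i) => ?; case: (ltnP k j) => ?; lia.
Qed.

Lemma index_enum_D2 n (i j k : 'I_n) : i != j -> k != i -> k != j ->
  (index k [seq l <- enum 'I_n | (l != i) && (l != j)] + (i < k)%N + (j < k)%N)%N
    = k.
Proof.
move=> ij ki kj; rewrite index_filter ?ki // index_enum_ord.
rewrite -(mem_take_enum_ord i) -(mem_take_enum_ord j) addnAC.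
rewrite (count_predD1 (p := fun l => l != i)) 1?eq_sym ?take_uniq ?enum_uniq //.
rewrite (count_predD1 (p := predT)) ?take_uniq ?enum_uniq //.
by rewrite count_predT size_takel // size_enum_ord ltnW.
Qed.

Lemma uniq_filter_enum (T : finType) (p : pred T) :
  uniq [seq i <- enum T | p i].
Proof. exact/filter_uniq/enum_uniq. Qed.

Lemma eq_signr (R : pzRingType) (a b : nat) :
  odd a = odd b -> (-1) ^+ a = (-1) ^+ b :> R.
Proof. by move=> ab; rewrite -signr_odd ab signr_odd. Qed.

(** * The operators A, B and D on cochains *)

Section Cochains.
Variables (K : fieldType) (g : lieAlgebra K).
Local Notation "[[ x , y ]]" := (@lie_br K g x y) (at level 0).
Local Notation M n := (multimap g n).

(** The operator A: the cup product, taken with the Lie bracket, of the identity map as a 1-cochain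
    with [f]. *)
Definition ad_cup n (f : M n) : M n.+1 := fun x =>
  \sum_(i < n.+1) (-1 : K) ^+ i *:
     [[ x i, f (args n [seq x k | k <- enum 'I_n.+1 & k != i]) ]].

Definition bracket_diff n (f : M n) : M n.+1 := fun x =>
  \sum_(i < n.+1) \sum_(j < n.+1 | (i < j)%N) (-1 : K) ^+ (i + j) *:
     f (args n ([[ x i, x j ]] ::
            [seq x k | k <- enum 'I_n.+1 & (k != i) && (k != j)])).

(** The operator D: the cup product of the bracket, as a 2-cochain, with [f]. The sign is that of
    the shuffle moving positions [i < j] to the front. *)
Definition ad2_cup n (f : M n) : M n.+2 := fun x =>
  \sum_(i < n.+2) \sum_(j < n.+2 | (i < j)%N) (-1 : K) ^+ (i + j).+1 *:
     [[ [[ x i, x j ]],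
        f (args n [seq x k | k <- enum 'I_n.+2 & (k != i) && (k != j)]) ]].

(** * Evaluation of the operators on labelled argument lists *)

Lemma args_tnth (I : eqType) n (x : I -> g) (t : n.-tuple I) k :
  args n (map x t) k = x (tnth t k).
Proof.
by rewrite ffunE (nth_map (tnth t k)) ?size_tuple // -tnth_nth.
Qed.

Lemma args_filter (I : eqType) n (x : I -> g) (t : n.-tuple I)
    (p : pred I) (q : pred 'I_n) :
  (forall k, q k = p (tnth t k)) ->
  [seq args n (map x t) k | k <- enum 'I_n & q k] = [seq x l | l <- t & p l].
Proof.
move=> pq; rewrite -{2}(map_tnth_enum t) filter_map -map_comp.
by rewrite (eq_filter pq); apply: eq_map => k; rewrite args_tnth.
Qed.

Lemma index_tnth (I : eqType) n (t : n.-tuple I) i :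
  uniq t -> index (tnth t i) t = i.
Proof.
by move=> ut; rewrite (tnth_nth (tnth t i)) index_uniq ?size_tuple.
Qed.

(** In a composite of two operators the inner one is evaluated on a sublist of the arguments.
    Summing over the labels in [s] instead of positions keeps the inner and outer indices in one
    type, so that they can be exchanged. *)
Lemma ad_cup_map (I : eqType) n (f : M n) (x : I -> g) (s : seq I) :
  uniq s -> size s = n.+1 ->
  ad_cup f (args n.+1 (map x s)) =
  \sum_(k <- s) (-1) ^+ index k s *:
     [[ x k, f (args n [seq x l | l <- s & l != k]) ]].
Proof.
move=> us /eqP sz; pose t := Tuple sz; rewrite -[s]/(tval t) big_tuple.
have inj : injective (tnth t) by apply/tuple_uniqP.
apply: eq_bigr => i _; rewrite args_tnth index_tnth //.
rewrite (@args_filter _ _ x t (fun l => l != tnth t i)) // => k.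
by rewrite (inj_eq inj).
Qed.

Lemma bracket_diff_map (I : eqType) n (f : M n) (x : I -> g) (s : seq I) :
  uniq s -> size s = n.+1 ->
  bracket_diff f (args n.+1 (map x s)) =
  \sum_(i <- s) \sum_(j <- s | (index i s < index j s)%N)
     (-1) ^+ (index i s + index j s) *:
     f (args n ([[ x i, x j ]] :: [seq x l | l <- s & (l != i) && (l != j)])).
Proof.
move=> us /eqP sz; pose t := Tuple sz; rewrite -[s]/(tval t) big_tuple.
have inj : injective (tnth t) by apply/tuple_uniqP.
apply: eq_bigr => i _; rewrite big_tuple index_tnth //.
apply: eq_big => j; rewrite index_tnth // => ij; rewrite !args_tnth.
rewrite (@args_filter _ _ x t (fun l => (l != tnth t i) && (l != tnth t j))) // => k.
by rewrite !(inj_eq inj).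
Qed.

Lemma size_filter_D1 n (i : 'I_n.+1) :
  size [seq l <- enum 'I_n.+1 | l != i] = n.
Proof.
rewrite size_filter; have := count_predC (pred1 i) (enum 'I_n.+1).
by rewrite count_uniq_mem ?enum_uniq // mem_enum size_enum_ord => -[].
Qed.

Lemma size_filter_D2 n (i j : 'I_n.+2) : i != j ->
  size [seq l <- enum 'I_n.+2 | (l != i) && (l != j)] = n.
Proof.
move=> ij; rewrite size_filter.
have := count_predD1 (p := fun l => l != i) (enum_uniq 'I_n.+2).
move=> /(_ j); rewrite eq_sym ij => /(_ isT).
by rewrite -!size_filter size_filter_D1 mem_enum addn1 => -[].
Qed.

(** * Composites of the operators and the homotopy formula *)

(** The Jacobi identity in the form that ad turns brackets into commutators. *)
Lemma lie_jacobi_ad (x y z : g) :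
  [[ x, [[ y, z ]] ]] - [[ y, [[ x, z ]] ]] = [[ [[ x, y ]], z ]].
Proof.
have := lie_jacobi x y z; rewrite (lie_skew [[ y, z ]] x).
rewrite (lie_skew [[ z, x ]] y) (lie_skew z x) linearNr opprK => /eqP.
by rewrite -addrA addr_eq0 opprD opprK => /eqP ->.
Qed.

(** The two orders of extracting a pair of arguments carry opposite signs, so each pair contributes
    a commutator of ad, which Jacobi turns into ad of the bracket. *)
Lemma ad_cup_ad_cup n (f : M n) : ad_cup (ad_cup f) = ad2_cup f.
Proof.
apply/funext => x; rewrite /ad2_cup.
pose T (i l : 'I_n.+2) := (-1 : K) ^+ (i + l) *: [[ x i, [[ x l,
  f (args n [seq x k | k <- enum 'I_n.+2 & (k != i) && (k != l)]) ]] ]].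
(* The factor with exponent [(i < l)] records that [l] moves down one place when an earlier [i] is
   removed. *)
have -> : ad_cup (ad_cup f) x = 
    \sum_(i < n.+2) \sum_(l < n.+2 | (l != i)) (-1) ^+ (i < l)%N *: T i l.
  apply: eq_bigr => i _.
  rewrite ad_cup_map ?uniq_filter_enum ?size_filter_D1 // big_filter big_enum_cond /=.
  rewrite linear_sumr scaler_sumr; apply: eq_bigr => l li.
  rewrite linearZr_LR /= -filter_predI /T !scalerA -!exprD.
  rewrite (@eq_filter _ (predI _ _) (fun k => (k != i) && (k != l))); last first.
    by move=> k /=; rewrite andbC.
  congr (_ *: _); apply: eq_signr.
  rewrite !oddD -[in odd l](index_enum_D1 li) oddD oddb.
  by rewrite [RHS]addbC -!addbA addbb addbF.
transitivity (\sum_(i < n.+2) \sum_(l < n.+2 | (i < l)%N) (T l i - T i l)).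
  transitivity (\sum_(i < n.+2) (\sum_(l < n.+2 | (l < i)%N) T i l
                                 - \sum_(l < n.+2 | (i < l)%N) T i l)).
    apply: eq_bigr => i _; rewrite (bigID (fun l : 'I__ => (l < i)%N)) /= -sumrN.
    congr (_ + _); apply: eq_big => l.
    - by rewrite -val_eqE /=; case: ltngtP.
    - move=> /andP[_ li]; rewrite ltnNge ltnW // expr0 scale1r //.
    - by rewrite -val_eqE /=; case: ltngtP.
    - rewrite -leqNgt -val_eqE /= => /andP[li il].
      by rewrite ltn_neqAle eq_sym li il expr1 scaleN1r.
  rewrite sumrB (exchange_big_dep predT) //= -sumrB.
  by apply: eq_bigr => i _; rewrite sumrB.
apply: eq_bigr => i _; apply: eq_bigr => l il.
rewrite /T (addnC l) -scalerBr.
rewrite (@eq_filter _ _ (fun k => (k != i) && (k != l))); last first.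
  by move=> k /=; rewrite andbC.
by rewrite -lie_jacobi_ad exprS mulN1r scaleNr -scalerN opprB.
Qed.

(** The leading argument [v] occupies position 0 and pushes the others up by one, whence the minus
    sign. It will be the bracket inserted by B. *)
Lemma ad_cup_cons (I : eqType) n (f : M n) (v : g) (x : I -> g) (s : seq I) :
  uniq s -> size s = n ->
  ad_cup f (args n.+1 (v :: map x s)) =
  [[ v, f (args n (map x s)) ]] -
  \sum_(k <- s) (-1) ^+ index k s *:
     [[ x k, f (args n (v :: [seq x l | l <- s & l != k])) ]].
Proof.
(* The label [None] stands for the extra argument, so the labels stay distinct whatever the value of
   [v]. *)
move=> us sz; pose y o := if o is Some k then x k else v.
have -> : v :: map x s = map y (None :: map Some s) by rewrite /= -map_comp.
rewrite ad_cup_map /= ?size_map ?sz //; last first.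
  by rewrite map_inj_uniq ?us ?andbT => [|? ? [] //]; apply/mapP => -[].
rewrite big_cons eqxx expr0 scale1r /=; congr (_ + _).
  rewrite filter_map -map_comp (@eq_filter _ _ predT) ?filter_predT //.
rewrite big_map -sumrN; apply: eq_bigr => k _ /=.
rewrite index_map => [|? ? [] //]; rewrite exprS mulN1r scaleNr.
rewrite filter_map -map_comp.
by rewrite (@eq_filter _ (preim _ _) (fun l => l != k)).
Qed.

(** Both composites contain the terms [U k i j], where [x k] is bracketed with a value of [f] on a
    list headed by [[[ x i, x j ]]]; these cancel. What remains of B A are the terms where A picks
    the inserted bracket itself, and they sum to - D. *)
Lemma ad_cup_bracket_diff n (f : M n) :
  ad_cup (bracket_diff f) + bracket_diff (ad_cup f) = - ad2_cup f.
Proof.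
apply/funext => x; rewrite !fctE.
pose p i j k : pred 'I_n.+2 := fun l => [&& l != i, l != j & l != k].
(* The two Booleans in the exponent are the shifts of [i] and [j] caused by deleting [k]. *)
pose U (k i j : 'I_n.+2) :=
  (-1 : K) ^+ ((k < i) + (k < j) + i + j + k)%N *: [[ x k,
  f (args n ([[ x i, x j ]] :: [seq x l | l <- enum 'I_n.+2 & p i j k l])) ]].
have -> : ad_cup (bracket_diff f) x =
    \sum_(k < n.+2) \sum_(i < n.+2 | i != k)
      \sum_(j < n.+2 | (j != k) && (i < j)%N) U k i j.
  apply: eq_bigr => k _.
  rewrite bracket_diff_map ?uniq_filter_enum ?size_filter_D1 //.
  rewrite big_filter big_enum_cond /= linear_sumr scaler_sumr.
  apply: eq_bigr => i ik.
  rewrite big_filter_cond big_enum_cond /= linear_sumr scaler_sumr.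
  apply: eq_big => [j|j /andP[jk ij] ].
    by case: (eqVneq j k) => //= jk; rewrite ltn_index_enum_D1.
  rewrite linearZr_LR /= -filter_predI !scalerA -exprD /U.
  rewrite (@eq_filter _ (predI _ _) (p i j k)); last first.
    by move=> l /=; rewrite /p -andbA.
  congr (_ *: _); apply: eq_signr.
  rewrite !oddD !oddb -[in odd i](index_enum_D1 ik) -[in odd j](index_enum_D1 jk).
  rewrite !oddD !oddb.
  by do 2! case: (odd (index _ _)); case: (odd k); do 2! case: (k < _)%N.
have -> : bracket_diff (ad_cup f) x = - ad2_cup f x -
    \sum_(i < n.+2) \sum_(j < n.+2 | (i < j)%N)
      \sum_(k < n.+2 | (k != i) && (k != j)) U k i j.
  rewrite -!sumrN -big_split; apply: eq_bigr => i _.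
  rewrite -!sumrN -big_split; apply: eq_bigr => j ij /=.
  have ij' : i != j by rewrite -val_eqE /= neq_ltn ij.
  rewrite ad_cup_cons ?uniq_filter_enum ?size_filter_D2 // scalerBr; congr (_ - _).
    by rewrite exprS mulN1r scaleNr opprK.
  rewrite big_filter big_enum_cond /= scaler_sumr.
  apply: eq_bigr => k /andP[ki kj].
  rewrite !scalerA -exprD -filter_predI /U.
  rewrite (@eq_filter _ (predI _ _) (p i j k)); last first.
    by move=> l /=; rewrite /p andbC -andbA.
  congr (_ *: _); apply: eq_signr.
  rewrite !oddD !oddb -[in odd k](index_enum_D2 ij' ki kj) !oddD !oddb.
  (* Here [k] is shifted by [(i < k) + (j < k)], which has the parity of [(k < i) + (k < j)] since
     both comparisons are reversed. *)
  have ltnN (l : 'I_n.+2) : k != l -> (l < k)%N = ~~ (k < l)%N.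
    by rewrite -val_eqE neq_ltn /=; case: ltngtP.
  rewrite (ltnN i ki) (ltnN j kj).
  case: (odd (index _ _)); case: (odd i); case: (odd j) => /=;
  by do 2! case: (k < _)%N.
rewrite addrC -addrA [X in _ + X]addrC; apply/eqP.
rewrite -subr_eq0 addrAC subrr add0r subr_eq0; apply/eqP.
rewrite (exchange_big_dep predT) //=; apply: eq_bigr => i _.
rewrite (exchange_big_dep (fun j : 'I__ => (i < j)%N)) /=; last first.
  by move=> k j _ /andP[].
apply: eq_bigr => j ij; apply: eq_bigl => k.
by rewrite ij andbT eq_sym [j == k]eq_sym.
Qed.

Lemma ce_diffE n (f : M n) : ce_diff f = ad_cup f + bracket_diff f.
Proof. by []. Qed.

Lemma ad_cup_linear n : linear (@ad_cup n).
Proof.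
move=> a f h; apply/funext => x; rewrite !fctE /ad_cup scaler_sumr -big_split.
by apply: eq_bigr => i _; rewrite linearPr scalerDr !scalerA mulrC.
Qed.

HB.instance Definition _ n :=
  GRing.isLinear.Build K (M n) (M n.+1) _ (@ad_cup n) (@ad_cup_linear n).

(** This is the graded Leibniz rule for the cup product with the identity 1-cochain, whose
    differential is the bracket. *)
Lemma ad_cup_homotopy n (f : M n) :
  ce_diff (ad_cup f) + ad_cup (ce_diff f) = ad2_cup f.
Proof.
rewrite !ce_diffE linearD /= ad_cup_ad_cup addrACA addrC addrACA.
by rewrite addrACA [bracket_diff _ + _]addrC ad_cup_bracket_diff addKr.
Qed.

(** * The operator A preserves alternating maps *)

Lemma args_D1 n (x : {ffun 'I_n.+1 -> g}) i :
  args n [seq x k | k <- enum 'I_n.+1 & k != i] = [ffun k => x (lift i k)].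
Proof.
apply/ffunP => k; rewrite !ffunE.
have ki : lift i k != i by rewrite eq_sym neq_lift.
have mem : lift i k \in [seq l <- enum 'I_n.+1 | l != i].
  by rewrite mem_filter ki mem_enum.
have idx : index (lift i k) [seq l <- enum 'I_n.+1 | l != i] = k.
  by have := index_enum_D1 ki; move: (index _ _) => a; rewrite /= /bump; lia.
by rewrite -{1}idx (nth_map (lift i k)) ?index_mem // nth_index.
Qed.

Definition is_multilinear n (f : M n) :=
  forall x i, linear (fun u => f (upd x i u)).

Lemma upd_id n (x : {ffun 'I_n -> g}) i : upd x i (x i) = x.
Proof. by apply/ffunP => k; rewrite ffunE; case: eqP => // ->. Qed.

(** Vanishing on equal neighbours gives, by polarization, a sign change under adjacent
    transpositions; these move one of two equal entries next to the other. *)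
Lemma is_alternating_adjacent n (f : M n) : is_multilinear f ->
  (forall (x : {ffun 'I_n -> g}) (i j : 'I_n),
     j = i.+1 :> nat -> x i = x j -> f x = 0) ->
  is_alternating f.
Proof.
move=> fl fadj; split=> // x i j; wlog ij : i j / (i < j)%N => [IH ij xij|_].
  have := ij; rewrite -val_eqE neq_ltn => /orP[] lt; first exact: (IH i j).
  by apply: (IH j i); rewrite // eq_sym.
have swap (y : {ffun 'I_n -> g}) (a b : 'I_n) : b = a.+1 :> nat ->
    f y = - f [ffun k => y (tperm a b k)].
  move=> ab; have ba : b != a by rewrite -val_eqE /= ab neq_ltn ltnSn orbT.
  pose h u v := f (upd (upd y a u) b v).
  have h0 u : h u u = 0.
    by apply: (fadj _ a b ab); rewrite !ffunE eqxx eq_sym (negbTE ba) eqxx.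
  have hDr u v w : h u (v + w) = h u v + h u w.
    by have := fl (upd y a u) b 1 v w; rewrite !scale1r.
  have updC u v : upd (upd y a u) b v = upd (upd y b v) a u.
    apply/ffunP => k; rewrite !ffunE; case: (eqVneq k b) => // ->.
    by rewrite (negbTE ba).
  have hDl u v w : h (u + v) w = h u w + h v w.
    by have := fl (upd y b w) a 1 u v; rewrite /h !updC !scale1r.
  have -> : f y = h (y a) (y b).
    by rewrite /h updC upd_id upd_id.
  have -> : [ffun k => y (tperm a b k)] = upd (upd y a (y b)) b (y a).
    apply/ffunP => k; rewrite !ffunE.
    by case: tpermP => [->|->|/eqP/negbTE -> /eqP/negbTE ->] //;
      rewrite ?eqxx // eq_sym (negbTE ba) ?eqxx.
  apply/eqP; rewrite -addr_eq0 -/(h _ _).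
  by have := h0 (y a + y b); rewrite hDl !hDr !h0 add0r addr0 => ->.
(* Induction on the distance, with [x] generalized because each transposition changes it. *)
move: {-1}(j - i)%N (erefl (j - i)%N) => d; elim: d x j ij => [|d IH] x j ij e xij.
  by lia.
have [ji|ji] := eqVneq (j : nat) i.+1; first exact: fadj xij.
have lt : (j.-1 < n)%N by have := ltn_ord j; lia.
pose j' := Ordinal lt.
rewrite (swap x j' j) /=; last by lia.
rewrite (IH _ j') ?oppr0 //=; try lia.
rewrite !ffunE tpermL tpermD //; rewrite -val_eqE /=; lia.
Qed.

(** If two neighbours [i] and [j] carry equal entries, every other summand still feeds both of them
    to [f] and vanishes, while the summands of [i] and [j] differ only in sign. *)
Lemma ad_cup_alternating n (f : M n) : f \in altmap g n ->
  ad_cup f \in altmap g n.+1.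
Proof.
move=> /asboolP[fl fa]; apply/asboolP; apply: is_alternating_adjacent.
  move=> x i a u v; rewrite /ad_cup scaler_sumr -big_split.
  apply: eq_bigr => k _; rewrite !args_D1 /=.
  have [->|ki] := eqVneq k i.
    have E w : [ffun l => upd x i w (lift i l)] = [ffun l => x (lift i l)].
      by apply/ffunP => l; rewrite !ffunE eq_sym (negbTE (neq_lift _ _)).
    by rewrite !E !ffunE eqxx linearPl scalerDr !scalerA mulrC.
  have [i' def_i _] := unlift_some ki.
  have E w : [ffun l => upd x i w (lift k l)] =
      upd [ffun l => x (lift k l)] i' w.
    by apply/ffunP => l; rewrite !ffunE def_i (inj_eq lift_inj).
  rewrite !E fl !ffunE (negbTE ki) linearPr.
  by rewrite scalerDr !scalerA mulrC.
move=> x i j ij xij; have ne : i != j by rewrite -val_eqE /= ij neq_ltn ltnSn.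
rewrite /ad_cup (bigD1 i) //= (bigD1 j) 1?eq_sym //= big1 => [|k /andP[ki kj] ]; last first.
  rewrite args_D1; have [i' def_i _] := unlift_some ki.
  have [j' def_j _] := unlift_some kj.
  rewrite (fa _ i' j') ?linear0r ?scaler0 //.
    by apply: contra ne => /eqP e; rewrite def_i def_j e.
  by rewrite !ffunE -def_i -def_j.
rewrite addr0 !args_D1 -xij ij exprS mulN1r scaleNr.
rewrite (_ : [ffun l => x (lift j l)] = [ffun l => x (lift i l)]) ?subrr //.
apply/ffunP => l; rewrite !ffunE.
have [li|li] := eqVneq (l : nat) i.
  have -> : lift j l = i by apply: val_inj; rewrite /= /bump ij li ltnn.
  by rewrite xij; congr (x _); apply: val_inj; rewrite /= /bump ij li leqnn.
congr (x _); apply: val_inj; rewrite /= /bump ij [(i <= _)%N]leq_eqVlt.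
by rewrite [_ == nat_of_ord l]eq_sym (negbTE li).
Qed.


(** * The alpha-type differential when alpha is the identity *)

Lemma alpha_delta_id e n (f : M n) :
  @alpha_delta K (homLie_of_lie g) e n.+1 f = ce_diff f.
Proof.
have iterE k (u : g) : iter k idfun u = u by elim: k.
apply/funext => x; rewrite /alpha_delta /ce_diff -sumrN; congr (_ + _).
  by apply: eq_bigr => i _; rewrite iterE.
apply: eq_bigr => i _; rewrite -sumrN; apply: eq_bigr => j _.
by rewrite exprS mulN1r scaleNr opprK.
Qed.

Lemma d_anu_id n (f : M n) : @d_anu K (homLie_of_lie g) n.+1 f = ad2_cup f.
Proof.
have iterE k (u : g) : iter k idfun u = u by elim: k.
apply/funext => x; rewrite /d_anu /ad2_cup.
by apply: eq_bigr => i _; apply: eq_bigr => j _; rewrite !iterE.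
Qed.

Lemma alpha_diff_id n (c : alpha_ambient (homLie_of_lie g) n.+1) :
  alpha_diff c = (ce_diff (c.1 : M n.+1) - ad2_cup c.2, - ce_diff (c.2 : M n)).
Proof.
rewrite /alpha_diff /d_nunu /d_aa !alpha_delta_id d_anu_id; congr (_, _).
rewrite (_ : d_nua c.1 = 0) ?sub0r //; apply/funext => x; rewrite /d_nua /=.
apply/eqP; rewrite subr_eq0; apply/eqP; congr (c.1 _).
by apply/ffunP => k; rewrite ffunE.
Qed.

End Cochains.

(** * The first isomorphism theorem for subquotients *)

Section FirstIsomorphism.
Local Open Scope quotient_scope.
Variables (K : fieldType) (V W : lmodType K) (Z B : submodClosed V).
Variable F : V -> W.
Hypothesis F_linear : forall a, {in Z &, forall u v,
  F (a *: u + v) = a *: F u + F v}.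
Hypothesis F_surj : forall w, exists2 z, z \in Z & F z = w.
Hypothesis F_ker : forall z, z \in Z -> (F z = 0 <-> z \in B).

Let Q := subquotient Z B.
Let G (u : Q) : W := F (\val (repr u)).

Let val_in (z : submodule Z) : \val z \in Z.
Proof. by case: z. Qed.

Let F_eq u v : u \in Z -> v \in Z -> (F u = F v <-> u - v \in B).
Proof.
move=> uZ vZ; rewrite addrC -scaleN1r -F_ker ?rpredD ?rpredZ //.
rewrite F_linear // scaleN1r addrC.
by split=> [->|/eqP]; rewrite ?subrr // subr_eq0 => /eqP.
Qed.

Let G_pi z : G (\pi_Q z) = F (\val z).
Proof.
have : repr (\pi_Q z) - z \in sub_preim Z B by rewrite -pi_eq reprK.
by rewrite inE raddfB => zB; apply/F_eq; rewrite ?val_in.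
Qed.

Let pi_linear a (x y : submodule Z) :
  \pi_Q (a *: x + y) = a *: (\pi_Q x : Q) + (\pi_Q y : Q).
Proof.
have -> : a *: (\pi_Q x : Q) = \pi_Q (a *: x) by exact: quotient_scale_pi.
exact: raddfD.
Qed.

(** Since [F] need only be linear on [Z], it can be a total map with arbitrary values elsewhere. By
    [F_eq] its value on a class does not depend on the representative, and distinct classes have
    distinct values. *)
Lemma subquotient_iso : lmod_isomorphic (subquotient Z B) W.
Proof.
have G_lin : linear G.
  move=> a u v; have [x ->] := pi_surj u; have [y ->] := pi_surj v.
  by rewrite -pi_linear !G_pi linearP F_linear ?val_in.
pose lin := GRing.isLinear.Build K Q W _ G G_lin.
pose f : {linear Q -> W} := HB.pack G lin.
exists f; have surj w : exists u : Q, G u = w.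
  have [z zZ <-] := F_surj w.
  by exists (\pi_Q (Submodule zZ)); rewrite G_pi.
exists (fun w => sval (cid (surj w))) => [u|w]; last by case: cid.
case: cid => v /=; have [x ->] := pi_surj u; have [y ->] := pi_surj v.
rewrite /f /= !G_pi => /F_eq; rewrite !val_in => /(_ isT isT) xy.
by apply/eqP; rewrite pi_eq inE raddfB.
Qed.

End FirstIsomorphism.

(** * The modified cohomology as cohomology of a truncated complex *)

Section Classes.
Local Open Scope quotient_scope.
Variables (K : fieldType) (g : lieAlgebra K).
Local Notation "[[ x , y ]]" := (@lie_br K g x y) (at level 0).
Local Notation M n := (multimap g n).

(** Cocycles of the Chevalley-Eilenberg complex with its degree 0 term replaced by 0. Its cohomology
    is the modified one: degree 0 gives 0, and in degree 1 no nonzero coboundary is left to divide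
    derivations by. *)
Definition reduced_cocycle n : {pred M n} :=
  [pred f : M n | (f \in altmap_pos g n) && (ce_diff f == 0)].

Arguments reduced_cocycle n _ : clear implicits.

Definition reduced_coboundary n : M n -> Prop :=
  match n with
  | 0 => fun f => f = 0
  | m.+1 => fun f => exists2 b, b \in altmap_pos g m & ce_diff b = f
  end.

Lemma altmap_posS n (f : M n.+1) :
  (f \in altmap_pos g n.+1) = (f \in altmap g n.+1).
Proof. by rewrite inE implyFb andbT. Qed.

Lemma altmap_pos0 (f : M 0) : (f \in altmap_pos g 0) = (f == 0).
Proof.
by rewrite inE /=; case: eqVneq => [->|_]; rewrite ?rpred0 ?andbF.
Qed.

(* cls induces an isomorphism from cocycles modulo coboundaries to W; a total
   map avoids carrying membership proofs. *)
Definition is_class_map n (W : lmodType K) (cls : M n -> W) :=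
  [/\ forall a, {in reduced_cocycle n &, forall u v,
       cls (a *: u + v) = a *: cls u + cls v},
     forall w, exists2 z, z \in reduced_cocycle n & cls z = w
   & {in reduced_cocycle n, forall z, cls z = 0 <-> reduced_coboundary z}].

Lemma class_map0 : is_class_map (fun _ : M 0 => 0 : 'rV[K]_0).
Proof.
split=> [a u v _ _|w|z].
- by rewrite scaler0 addr0.
- exists 0; last by rewrite thinmx0.
  by rewrite inE rpred0 linear0 eqxx.
- by rewrite inE altmap_pos0 => /andP[/eqP -> _].
Qed.

Definition unary (f : M 1) : g -> g := fun u => f [ffun=> u].

Lemma ce_diff1 (f : M 1) (z : {ffun 'I_2 -> g}) :
  let x := z ord0 in let y := z (lift ord0 ord0) in
  ce_diff f z = [[ x, unary f y ]] - [[ y, unary f x ]] - unary f [[ x, y ]].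
Proof.
move=> x y; rewrite ce_diffE fctE /ad_cup /bracket_diff !big_ord_recl !big_ord0.
rewrite !args_D1 !addr0.
rewrite ![\sum_(j < 2 | _) _]big_mkcond !big_ord_recl !big_ord0 /= !addr0 !add0r.
rewrite expr0 expr1 !scale1r !scaleN1r.
rewrite [X in _ + (_ + X)]big1 ?addr0 => [|[ [|[|//] ] ?] //].
congr (_ - _ - _); rewrite /unary; do ?congr [[ _, _ ]]; congr (f _);
  apply/ffunP => k; rewrite !ffunE (ord1 k) //=.
by congr (z _); apply: val_inj.
Qed.

Lemma unary_upd (f : M 1) (x : {ffun 'I_1 -> g}) i u :
  f (upd x i u) = unary f u.
Proof. by congr (f _); apply/ffunP => k; rewrite !ffunE !ord1. Qed.

(** Being alternating in one variable is just linearity, and by skew-symmetry the vanishing of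
    [ce_diff1] is the Leibniz rule. *)
Lemma unary_derivation (f : M 1) :
  (unary f \in @derivation K g) = (f \in reduced_cocycle 1).
Proof.
rewrite [RHS]inE altmap_posS; apply/asboolP/andP => [ [Dl DP]|[/asboolP[fl _] /eqP df] ].
  split.
    apply/asboolP; split=> [x i|x i j]; last by rewrite !ord1.
    by move=> a u v; rewrite !unary_upd Dl.
  apply/eqP/funext => z; rewrite ce_diff1 DP -(lie_skew (unary f _)).
  by rewrite [X in X - _]addrC subrr.
split=> [a u v|x y].
  by have := fl [ffun=> 0] ord0 a u v; rewrite !unary_upd.
have := ce_diff1 f [ffun i => if i == ord0 then x else y].
rewrite df !ffunE /= -(lie_skew (unary f _)) => /esym/eqP.
by rewrite subr_eq0 addrC => /eqP ->.
Qed.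

Lemma unaryK (D : g -> g) : unary (fun x : {ffun 'I_1 -> g} => D (x ord0)) = D.
Proof. by apply/funext => u; rewrite /unary ffunE. Qed.

Lemma reduced_coboundary1 (f : M 1) : reduced_coboundary f <-> f = 0.
Proof.
split=> [ [b]|->]; last by exists 0; rewrite ?rpred0 ?linear0.
by rewrite altmap_pos0 => /eqP -> <-; rewrite linear0.
Qed.

(** A cocycle is its own class here; the default 0 of [insubd] is only reached off the cocycles. *)
Lemma class_map1 : is_class_map (fun f : M 1 => insubd (0 : Der g) (unary f)).
Proof.
have valD f : f \in reduced_cocycle 1 ->
    \val (insubd (0 : Der g) (unary f)) = unary f.
  by rewrite -unary_derivation => Df; rewrite insubdK.
have closed a u v : u \in reduced_cocycle 1 ->
    v \in reduced_cocycle 1 -> a *: u + v \in reduced_cocycle 1.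
  rewrite -!unary_derivation => uD vD.
  by rewrite (_ : unary _ = a *: unary u + unary v) // rpredD ?rpredZ.
split=> [a u v uZ vZ|D|f fZ].
- by apply: val_inj; rewrite linearP /= !valD ?closed.
- exists (fun x : {ffun 'I_1 -> g} => \val D (x ord0)).
    by rewrite -unary_derivation unaryK; case: D.
  apply: val_inj; rewrite valD ?unaryK // -unary_derivation unaryK; by case: D.
- rewrite reduced_coboundary1; split=> [f0|->].
    apply/funext => x; have := congr1 val f0; rewrite valD // => /(congr1 (@^~ (x ord0))).
    by rewrite -(unary_upd f x ord0) upd_id.
  by apply: val_inj; rewrite valD // inE rpred0 linear0 eqxx.
Qed.

(** From degree 2 on, cocycles and coboundaries involve only cochains of positive degree, which the
    truncation leaves unchanged. *)
Lemma quotient_class_map n (Q := ce_cohomology g n.+2)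
    (cocycle := fun f : M n.+2 =>
       insubd (0 : submodule (@ce_cocycle K g n.+2)) f) :
  is_class_map (fun f : M n.+2 => \pi_Q (cocycle f) : Q).
Proof.
have coE (f : M n.+2) :
    (f \in reduced_cocycle n.+2) = (f \in @ce_cocycle K g n.+2).
  by rewrite inE altmap_posS.
have valI f : f \in reduced_cocycle n.+2 -> \val (cocycle f) = f.
  by rewrite coE => fZ; rewrite /cocycle insubdK.
split=> [a u v uZ vZ|w|f fZ].
- have -> : a *: (\pi_Q (cocycle u) : Q) = \pi_Q (a *: cocycle u).
    exact: quotient_scale_pi.
  rewrite -[RHS]raddfD; congr \pi_Q; apply: val_inj.
  rewrite linearP /= !valI //; rewrite !coE in uZ vZ *.
  by rewrite rpredD ?rpredZ.
- have [z ->] := pi_surj w; have zZ : \val z \in reduced_cocycle n.+2.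
    by rewrite coE; case: z.
  by exists (\val z) => //; congr \pi_Q; apply: val_inj; rewrite valI.
- have -> : (0 : Q) = \pi_Q 0 by rewrite raddf0.
  split=> [/eqP|].
    rewrite pi_eq subr0 inE valI // => /asboolP/asboolP[b bA bf].
    by exists b; rewrite ?altmap_posS.
  case=> b; rewrite altmap_posS => bA bf; apply/eqP; rewrite pi_eq subr0 inE valI //.
  by apply/asboolP/asboolP; exists b.
Qed.

Lemma class_map_exists n :
  exists cls : M n -> modified_cohomology g n, is_class_map cls.
Proof.
case: n => [|[|n] ].
- by exists (fun _ => 0); exact: class_map0.
- by eexists; exact: class_map1.
- by eexists; exact: quotient_class_map.
Qed.

End Classes.
Arguments reduced_cocycle {K g} n _.

(** * Splitting of the mapping cone *)

Section Comparison.
Variables (K : fieldType) (g : lieAlgebra K).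
Local Notation M n := (multimap g n).
Local Notation C n := (alpha_ambient (homLie_of_lie g) n).

Lemma alpha_cochainS n (c : C n.+1) :
  (c \in @alpha_cochain K (homLie_of_lie g) n.+1) =
  (c.1 \in altmap_pos g n.+1) && (c.2 \in altmap_pos g n).
Proof. by rewrite [LHS]inE. Qed.

Lemma ad_cup_altmap_pos n (f : M n) : f \in altmap_pos g n ->
  ad_cup f \in altmap_pos g n.+1.
Proof. by rewrite altmap_posS => /andP[fA _]; exact: ad_cup_alternating. Qed.

(** For closed [psi] the last term drops out, so the shifted cochain is closed exactly when the
    first cocycle equation of the cone holds. *)
Lemma ce_diff_shift n (phi : M n.+1) (psi : M n) :
  ce_diff (phi - ad_cup psi) = ce_diff phi - ad2_cup psi + ad_cup (ce_diff psi).
Proof.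
rewrite linearB /= -(ad_cup_homotopy psi).
by rewrite [in RHS]opprD [in RHS]addrA addrNK.
Qed.

Definition shift_cochain n (c : C n.+1) : M n.+1 := c.1 - ad_cup (c.2 : M n).

Lemma shift_cochain_linear n a (c d : C n.+1) :
  shift_cochain (a *: c + d) = a *: shift_cochain c + shift_cochain d.
Proof. by rewrite /shift_cochain ad_cup_linear scalerBr opprD addrACA. Qed.

Lemma alpha_cocycle_shift n (c : C n.+1) :
  (c \in @alpha_cocycle K (homLie_of_lie g) n.+1) =
  (shift_cochain c \in reduced_cocycle n.+1) &&
  ((c.2 : M n) \in reduced_cocycle n).
Proof.
rewrite [LHS]inE alpha_cochainS alpha_diff_id [_ \in reduced_cocycle n.+1]inE.
rewrite [_ \in reduced_cocycle n]inE /shift_cochain ce_diff_shift.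
rewrite -[0]/(0, 0) xpair_eqE oppr_eq0.
have [c2A|] := boolP (c.2 \in altmap_pos g n); last by rewrite !andbF.
have [->|] := eqVneq (ce_diff (c.2 : M n)) 0; last by rewrite !andbF.
rewrite linear0 addr0 !andbT; congr (_ && _).
apply/idP/idP => [c1A|c1A]; last rewrite -[c.1](subrK (ad_cup (c.2 : M n))).
  by rewrite rpredD // -scaleN1r rpredZ // ad_cup_altmap_pos.
by rewrite rpredD // ad_cup_altmap_pos.
Qed.

(** The shift carries the cone differential to d on the first component and - d on the second.
    Degree 1 is separate: there the only source cochain is 0. *)
Lemma alpha_coboundary_shift n (c : C n.+1) :
  c \in @alpha_coboundary K (homLie_of_lie g) n.+1 <->
  reduced_coboundary (shift_cochain c) /\ reduced_coboundary (c.2 : M n).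
Proof.
split=> [/asboolP[b]|].
  case: n c b => [|n] c b.
    rewrite inE !altmap_pos0 => /andP[/eqP b1 /eqP b2].
    have -> : b = 0 by case: b b1 b2 => /= ? ? -> ->.
    rewrite linear0 => <-; split=> //; exists 0; first exact: rpred0.
    by rewrite /shift_cochain [ad_cup _]linear0 subr0 linear0.
  rewrite alpha_cochainS => /andP[b1A b2A] <-.
  rewrite alpha_diff_id; split; last first.
    by exists (- (b.2 : M n)); rewrite ?linearN // -scaleN1r rpredZ.
  exists (shift_cochain b).
    by rewrite rpredD // -scaleN1r rpredZ // ad_cup_altmap_pos.
  by rewrite /shift_cochain ce_diff_shift /= linearN opprK.
case: n c => [|n] c [ [b bA bE] cE]; apply/asboolP.
  exists 0; first exact: rpred0.
  rewrite linear0; move: bA bE; rewrite altmap_pos0 => /eqP ->.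
  rewrite linear0 /shift_cochain; move: c cE => [c1 c2] /= ->.
  by rewrite linear0 subr0 => <-.
case: cE => b' b'A b'E.
(* The sign matches the second component - d of the cone differential. *)
have [psi psiA dpsi] : exists2 psi, psi \in altmap_pos g n & ce_diff psi = - c.2.
  by exists (- b'); rewrite ?linearN /= ?b'E // -scaleN1r rpredZ.
(* The pair [(b, psi)] is moved back by the inverse of the shift. *)
exists ((b + ad_cup psi, psi) : C n.+1).
  by rewrite alpha_cochainS psiA andbT rpredD // ad_cup_altmap_pos.
have := ce_diff_shift (b + ad_cup psi) psi.
rewrite addrK bE dpsi [ad_cup (- _)]linearN => dphi.
rewrite alpha_diff_id /= dpsi opprK -(addIr _ dphi).
by case: c {bE b'E dpsi dphi}.
Qed.

End Comparison.

Theorem theorem2p7 (K : fieldType) (charK0 : [pchar K] =i pred0)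
    (g : lieAlgebra K) (n : nat) (n_ge1 : (1 <= n)%N) :
  lmod_isomorphic (alpha_cohomology (homLie_of_lie g) n)
    (modified_cohomology g n * modified_cohomology g n.-1)%type.
Proof.
case: n n_ge1 => // n _ /=.
have [cls1 [lin1 surj1 ker1]] := class_map_exists g n.+1.
have [cls0 [lin0 surj0 ker0]] := class_map_exists g n.
apply: (@subquotient_iso _ _ _ _ _ (fun c => (cls1 (shift_cochain c), cls0 c.2))).
- move=> a u v; rewrite !alpha_cocycle_shift => /andP[u1 u2] /andP[v1 v2].
  congr (_, _); last exact: lin0.
  by rewrite shift_cochain_linear lin1.
- move=> [w1 w0]; have [z1 z1Z <-] := surj1 w1; have [z0 z0Z <-] := surj0 w0.
  (* The inverse of the shift turns a pair of cocycles into a cocycle of the cone. *)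
  have zE : shift_cochain (z1 + ad_cup z0, z0) = z1 by exact: addrK.
  by exists (z1 + ad_cup z0, z0); rewrite ?alpha_cocycle_shift zE ?z1Z.
- move=> c; rewrite alpha_cocycle_shift => /andP[c1Z c2Z].
  rewrite alpha_coboundary_shift -ker1 // -ker0 //.
  by split=> [ [-> ->]|[-> ->] ].
Qed.
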